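(* Let $c,N\in\mathbb{N}$ and let $X_1,X_2,\ldots$ be independent, non-negative, integer-valued random variables such that $X_{i+N}$ has the same distribution as $X_i$ for every $i\in\mathbb{N}$. For $u\in\mathbb{N}\cup\{0\}$ consider the surplus process of the discrete-time risk model $$W(t)=u+ct-\sum_{i=1}^{\lfloor t\rfloor}X_i,\quad t\geqslant 0,$$ and let $\psi(u)$ be its ultimate time ruin probability. Let $S_N=X_1+X_2+\ldots+X_N$. If $cN-\mathbb{E}S_N=0$ and $\mathbb{P}(S_N=cN)<1$, then $\psi(u)=1$ for all $u\in\mathbb{N}\cup\{0\}$.
   Context: Here $\mathbb{N}=\{1,2,3,\ldots\}$ and $\lfloor\cdot\rfloor$ is the floor function. The random variables $X_i$ (claim amounts) are not assumed identically distributed unless $N=1$. In the discrete-time risk model with initial surplus $u\in\mathbb{N}\cup\{0\}$ and premium rate $c$, the ruin time is $\tau_u=\min\{t\in\mathbb{N}: W(t)<0\}$, with $\tau_u=\infty$ if $W(t)\geqslant 0$ for all $t\in\mathbb{N}$. The ultimate time ruin probability is $$\psi(u)=\mathbb{P}(\tau_u<\infty)=\mathbb{P}\left(\sup_{k\geqslant 1}\sum_{i=1}^k (X_i-c)>u\right).$$ *)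

(* Defs.v *)
From mathcomp Require Import all_boot all_order all_algebra finmap.
From mathcomp Require Import all_classical all_reals all_analysis.

Set Implicit Arguments.
Unset Strict Implicit.
Unset Printing Implicit Defensive.

Import Order.TTheory GRing.Theory Num.Theory.

Local Open Scope classical_set_scope.
Local Open Scope ring_scope.

Definition mutually_independent (d d' : measure_display) (T : measurableType d)
    (T' : measurableType d') (R : realType) (P : probability T R)
    (I : choiceType) (D : set I) (X : I -> {RV P >-> T'}) : Prop :=
  forall (J : {fset I}) (A : I -> set T'),
    [set` J] `<=` D ->
    (forall j, j \in J -> measurable (A j)) ->
    P (\bigcap_(j in [set` J]) (X j @^-1` A j)) =
      (\prod_(j <- J) P (X j @^-1` A j))%E.

Definition same_distribution (d d' : measure_display) (T : measurableType d)
    (T' : measurableType d') (R : realType) (P : probability T R)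
    (X Y : {RV P >-> T'}) : Prop :=
  forall A : set T', measurable A -> distribution P X A = distribution P Y A.

Section RiskModel.
Context (d : measure_display) (T : measurableType d) (R : realType).
Context (P : probability T R).
Implicit Types (c u : nat) (X : nat -> {RV P >-> R}) (w : T).

(* Claims are indexed from 1, so [X 0] is never used. *)
Definition claim_sum X (n : nat) (w : T) : R := \sum_(1 <= i < n.+1) X i w.

(* Intended for [0 <= t], where [Num.truncn t] is the floor of [t]. *)
Definition surplus c X u (t : R) (w : T) : R :=
  u%:R + c%:R * t - claim_sum X (Num.truncn t) w.

Definition ruined_at c X u (w : T) : pred nat :=
  fun t => (0 < t)%N && (surplus c X u t%:R w < 0).

Definition ruin_time c X u (w : T) : \bar R :=
  match pselect (exists t, ruined_at c X u w t) with
  | left ruined => (ex_minn ruined)%:R%:E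
  | right _ => +oo%E
  end.

Definition ruin_probability c X u : \bar R :=
  P [set w | (ruin_time c X u w < +oo)%E].

End RiskModel.

(* Main.v *)
Require Import Defs.
From mathcomp Require Import all_boot all_order all_algebra finmap.
From mathcomp Require Import all_classical all_reals all_analysis.
From mathcomp Require Import measurable_realfun ring lra zify.

Set Implicit Arguments.
Unset Strict Implicit.
Unset Printing Implicit Defensive.

Import Order.TTheory GRing.Theory Num.Theory.
Import numFieldNormedType.Exports.

Local Open Scope classical_set_scope.
Local Open Scope ring_scope.

(** Write [m = c * N]. Premiums over one period of [N] claims amount to [m], so
at the ends of the periods the surplus is a random walk started at [u] whose
increments are [m - Z], where [Z] runs through independent copies of [S_N] and
has mean [m]. It is enough to show that this walk almost surely becomes
negative, and no general recurrence theorem is needed for that.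

Let [p] be the law of [Z]. The probability [survival m p n v] that the walk
started at [v] is nonnegative at its first [n] steps satisfies the one-step
recurrence of [survival_step] ([prob_solvent]). It decreases in [n], and its
limit [h] is a bounded nondecreasing solution of
[h v = \sum_(j <= v + m) p j * h (v + m - j)]. Summing this equation by parts
([renewalS], [renewal_invariant]) shows that
[\sum_(k < m) h (n + k) - \sum_(i < n + m) P (Z > i) * h (n + m - 1 - i)]
has for every [n] the same value, namely
[C = \sum_(k < m) P (Z <= k) * h (m - 1 - k)]. As [n] grows, both sums tend to
[m] times the limit of [h]: the first trivially, the second because
[\sum_i P (Z > i)] is the mean [m] ([sum_tail_expectation]). Hence [C <= 0],
and since [Z] has mean [m] but is not almost surely [m], it is smaller than [m]
with positive probability; this forces [h 0 = 0] ([fixpoint_at0]). The equation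
at a zero of [h] then produces the next zero ([fixpoint_eq0]), so [h] vanishes
([survival_cvg0]) and survival has probability zero.

The probabilistic part rests on the product formula for the cylinder events
[box s] that prescribe the first claims; it identifies the law of a block of
claims and its independence from past and future ([prob_block]). *)

(** * The survival recurrence of a driftless walk *)

Lemma cvg_sum_ord (R : realType) k (f : 'I_k -> nat -> R) (a : 'I_k -> R) :
  (forall i, f i n @[n --> \oo] --> a i) ->
  \sum_(i < k) f i n @[n --> \oo] --> \sum_(i < k) a i.
Proof. by move=> cf; apply: cvg_big => [|i _]; [exact: add_continuous|]. Qed.

Section Harmonic.
Context (R : realType) (m : nat) (p : nat -> R).
Hypothesis m_gt0 : (0 < m)%N.
Hypothesis p_ge0 : forall j, 0 <= p j.

Definition tail (i : nat) : R := 1 - \sum_(j < i.+1) p j.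

Hypothesis tail_ge0 : forall i, 0 <= tail i.
Hypothesis sum_tail : (fun n => \sum_(i < n) tail i) @ \oo --> (m%:R : R).
Hypothesis p_m_lt1 : p m < 1.

(** If [h v] is the probability of some future behaviour of the walk started at
[v], this is the probability that the next increment [m - j] does not make the
walk negative and that this behaviour follows. The increments with
[j > v + m], which lead to ruin, are left out. *)
Definition survival_step (h : nat -> R) (v : nat) : R :=
  \sum_(j < (v + m).+1) p j * h (v + m - j)%N.

Lemma tail_diff i : tail i - tail i.+1 = p i.+1.
Proof. by rewrite /tail [in X in _ - X]big_ord_recr /=; ring. Qed.

Lemma partial_tail_le n : \sum_(i < n) tail i <= m%:R.
Proof.
have nd : nondecreasing_seq (fun n => \sum_(i < n) tail i).
  by apply/nondecreasing_seqP => k; rewrite big_ord_recr /= lerDl.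
have := nondecreasing_cvgn_le nd (cvgP _ sum_tail) n.
by rewrite (cvg_lim _ sum_tail).
Qed.

(** Otherwise [tail i = 1] for [i < m], so these terms alone exhaust the mean [m];
then [tail m = 0], and all the mass sits at [m]. *)
Lemma small_atom : exists2 j, (j < m)%N & 0 < p j.
Proof.
apply: contrapT => no_atom.
have p0 j : (j < m)%N -> p j = 0.
  move=> jm; apply/eqP; rewrite eq_le p_ge0 andbT leNgt; apply/negP => pj.
  by apply: no_atom; exists j.
have tail1 i : (i < m)%N -> tail i = 1.
  move=> im; rewrite /tail big1 ?subr0 // => j _.
  by apply: p0; apply: leq_ltn_trans im; rewrite -ltnS.
have := partial_tail_le m.+1.
rewrite big_ord_recr /= (eq_bigr (fun=> 1)) => [|i _]; last exact: tail1.
rewrite sumr_const card_ord gerDl => /le_gtF/negP tm; apply: tm.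
rewrite /tail big_ord_recr /= big1 ?add0r ?subr_gt0 // => j _.
exact: p0.
Qed.

Section FixedPoint.
Variable h : nat -> R.
Hypothesis h_ge0 : forall v, 0 <= h v.
Hypothesis h_le1 : forall v, h v <= 1.
Hypothesis h_nd : nondecreasing_seq h.
Hypothesis h_fix : forall v, h v = survival_step h v.

(** The convolution of [h] with the tail function, which appears when the
equation [h = survival_step h] is summed over an interval of starting points. *)
Definition renewal (n : nat) : R :=
  \sum_(i < n + m) tail i * h (n + m - i.+1)%N.

(** Since [tail i - tail i.+1 = p i.+1], the increment of the convolution is
[h (n + m)] minus the right-hand side of the equation for [h n]. *)
Lemma renewalS n : renewal n.+1 - renewal n = h (n + m)%N - h n.
Proof.
rewrite [in RHS](h_fix n) /renewal /survival_step addSn.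
rewrite !big_ord_recl /= subSS subn0.
have -> : tail 0 = 1 - p 0%N by rewrite /tail big_ord1.
have -> : \sum_(i < n + m) p (bump 0 i) * h (n + m - bump 0 i)%N =
    \sum_(i < n + m) tail i * h (n + m - i.+1)%N -
    \sum_(i < n + m) tail (bump 0 i) * h ((n + m).+1 - (bump 0 i).+1)%N.
  rewrite -sumrB; apply: eq_bigr => i _.
  by rewrite /bump add1n subSS -mulrBl tail_diff.
ring.
Qed.

Lemma renewal_invariant n :
  \sum_(k < m) h (n + k)%N - renewal n =
  \sum_(k < m) (1 - tail k) * h (m - k.+1)%N.
Proof.
elim: n => [|n IHn].
  rewrite /renewal add0n.
  rewrite (reindex_inj rev_ord_inj) -sumrB /=.
  apply: eq_bigr => k _.
  by rewrite add0n; ring.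
rewrite -{}IHn.
have := renewalS n.
have : \sum_(k < m) h (n.+1 + k)%N - \sum_(k < m) h (n + k)%N =
       h (n + m)%N - h n.
  transitivity (\sum_(k < m.+1) h (n + k)%N - h n - \sum_(k < m) h (n + k)%N).
    rewrite big_ord_recl /= addn0 [h n + _]addrC addrK.
    congr (_ - _); apply: eq_bigr => i _.
    by rewrite /bump /= addSn addnA addn1.
  by rewrite big_ord_recr /=; ring.
lra.
Qed.

(** The invariant [C] is a limit of differences of two sums that both tend to
[m * limn h], so it is nonpositive; all its terms are nonnegative, and the one
containing [h 0] has the positive factor [1 - tail m.-1]. *)
Lemma fixpoint_at0 : h 0%N = 0.
Proof.
have cvg_h : cvgn h.
  apply: (nondecreasing_is_cvgn h_nd); exists 1 => _ [v _ <-]; exact: h_le1.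
pose L := limn h.
have hL v : h v <= L by apply: nondecreasing_cvgn_le.
set C := \sum_(k < m) (1 - tail k) * h (m - k.+1)%N.
(* Only the first [M] terms of the convolution are kept, so that the limit in [n]
   is taken in a finite sum; the limit in [M] comes afterwards. *)
have boundM M : C + L * (\sum_(i < M) tail i) <= m%:R * L.
  have cvgM : (fun n => C + \sum_(i < M) tail i * h (n + (M + m) - i.+1)%N)
      @ \oo --> C + \sum_(i < M) tail i * L.
    apply: cvgD; first exact: cvg_cst.
    apply: cvg_sum_ord => i; apply: cvgMl_tmp.
    have -> : (fun n => h (n + (M + m) - i.+1)%N) =
        (fun n => h (n + (M + m - i.+1))%N).
      by apply/funext => n; rewrite addnBA // ltn_addr.
    by rewrite (cvg_shiftn _ h).
  rewrite mulr_sumr (eq_bigr (fun i : 'I_M => tail i * L)); last first.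
    by move=> i _; rewrite mulrC.
  rewrite -(cvg_lim _ cvgM) //; apply: limr_le; first exact: cvgP cvgM.
  apply: nearW => n.
  have := renewal_invariant (n + M); rewrite -/C => inv.
  have le1 : \sum_(i < M) tail i * h (n + (M + m) - i.+1)%N <= renewal (n + M).
    rewrite /renewal -addnA addnCA big_split_ord /= lerDl.
    by apply: sumr_ge0 => i _; apply: mulr_ge0.
  have le2 : \sum_(k < m) h (n + M + k)%N <= m%:R * L.
    rewrite mulr_natl -[in leRHS](card_ord m) -sumr_const.
    by apply: ler_sum.
  lra.
have C_le0 : C <= 0.
  have cvgM : (fun M => C + L * (\sum_(i < M) tail i)) @ \oo --> C + L * m%:R.
    by apply: cvgD; [exact: cvg_cst|apply: cvgMl_tmp].
  have : C + L * m%:R <= m%:R * L.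
    rewrite -(cvg_lim _ cvgM) //; apply: limr_le; first exact: cvgP cvgM.
    exact: nearW.
  by rewrite [L * _]mulrC gerDr.
have term_ge0 (k : 'I_m) : 0 <= (1 - tail k) * h (m - k.+1)%N.
  by rewrite mulr_ge0 // /tail opprB addrC subrK sumr_ge0.
have [j jm pj] := small_atom.
have : (1 - tail m.-1) * h 0%N <= 0.
  apply: le_trans C_le0; rewrite /C.
  have m1 : (m.-1 < m)%N by rewrite prednK.
  rewrite (bigD1 (Ordinal m1)) //= prednK // subnn lerDl.
  exact: sumr_ge0.
rewrite pmulr_rle0 => [h0|]; first by apply/eqP; rewrite eq_le h0 h_ge0.
rewrite /tail opprB addrC subrK prednK //.
rewrite (bigD1 (Ordinal jm)) //= ltr_pwDl // sumr_ge0 // => k _.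
Qed.

(** If [h v = 0], the equation at [v] makes [h] vanish at [v + m - j] for an atom
[j < m], hence at [v.+1] by monotonicity. *)
Lemma fixpoint_eq0 v : h v = 0.
Proof.
elim: v => [|v IHv]; first exact: fixpoint_at0.
have [j jm pj] := small_atom.
have jv : (j < (v + m).+1)%N by rewrite ltnS ltnW // ltn_addl.
have : p j * h (v + m - j)%N <= 0.
  rewrite -[leRHS]IHv [leRHS]h_fix /survival_step (bigD1 (Ordinal jv)) //= lerDl.
  by apply: sumr_ge0 => k _; apply: mulr_ge0.
rewrite pmulr_rle0 // => hle0.
apply/eqP; rewrite eq_le h_ge0 andbT (le_trans _ hle0) //.
by apply: h_nd; rewrite -addnBA ?(ltnW jm) // -addn1 leq_add2l subn_gt0.
Qed.

End FixedPoint.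

Definition survival (n : nat) : nat -> R := iter n survival_step (fun=> 1).

Lemma survival_ge0 n v : 0 <= survival n v.
Proof.
by elim: n v => [|n IHn] v //=; apply: sumr_ge0 => j _; rewrite mulr_ge0.
Qed.

Lemma survivalS_le n v : survival n.+1 v <= survival n v.
Proof.
elim: n v => [|n IHn] v.
  rewrite /= /survival_step (eq_bigr (fun j : 'I_(v + m).+1 => p j)) => [|j _].
    by rewrite -subr_ge0 -/(tail _).
  by rewrite mulr1.
rewrite /= -/(survival _) /survival_step.
by apply: ler_sum => j _; rewrite ler_wpM2l // IHn.
Qed.

Lemma survival_nd n : nondecreasing_seq (survival n).
Proof.
elim: n => [|n IHn] //; apply/nondecreasing_seqP => v.
rewrite /= -/(survival _) /survival_step addSn [leRHS]big_ord_recr /=.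
rewrite -[leLHS]addr0 lerD ?mulr_ge0 ?survival_ge0 //.
apply: ler_sum => j _; rewrite ler_wpM2l //; apply: IHn.
by rewrite leq_sub2r.
Qed.

Lemma survival_cvg0 v : survival n v @[n --> \oo] --> (0 : R).
Proof.
have ni u : nonincreasing_seq (fun n => survival n u).
  by apply/nonincreasing_seqP => n; exact: survivalS_le.
have cv u : cvgn (fun n => survival n u).
  apply: (nonincreasing_is_cvgn (ni u)); exists 0 => _ [n _ <-].
  exact: survival_ge0.
pose h u := limn (fun n => survival n u).
suff h0 : h v = 0 by rewrite -h0; exact: cv.
apply: fixpoint_eq0 => [u|u|a b ab|u].
- by apply: limr_ge => //; apply: nearW => n; exact: survival_ge0.
- by apply: le_trans (nonincreasing_cvgn_ge (ni u) (cv u) 0%N) _.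
- apply: ler_lim => //; apply: nearW => n; exact: survival_nd.
- have cs : (fun n => survival n.+1 u) @ \oo --> h u.
    by rewrite (cvg_shiftS (fun n => survival n u)); exact: cv.
  rewrite -(cvg_lim _ cs) //; apply: cvg_lim => //.
  by apply: cvg_sum_ord => j; apply: cvgMl_tmp; exact: cv.
Qed.

End Harmonic.

(** * Laws of blocks of independent integer claims *)

Lemma prob_classify (d : measure_display) (T : measurableType d) (R : realType)
    (P : probability T R) (D : set T) (g : T -> nat) (n : nat) :
  measurable D -> (forall j, measurable [set w | g w = j]) ->
  (forall w, D w -> (g w < n)%N) ->
  fine (P D) = \sum_(j < n) fine (P (D `&` [set w | g w = j])).
Proof.
move=> mD mg gn.
have mDg j : measurable (D `&` [set w | g w = j]) by exact: measurableI.
rewrite sum_fine => [|j _]; last exact: fin_num_measure.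
rewrite -(measure_semi_additive_ord_I P (fun j _ => mDg j)).
- congr (fine (P _)).
  rewrite -(bigcup_mkord n (fun j => D `&` [set w | g w = j])).
  apply/seteqP; split => [w Dw|w [j _ []]//].
  by exists (g w) => //=; exact: gn.
- by move=> j k _ _ [w [[_ <-] [_ <-]]].
- by apply: bigsetU_measurable.
Qed.

Section Blocks.
Context (d : measure_display) (T : measurableType d) (R : realType).
Context (P : probability T R) (Y : nat -> T -> nat) (q : nat -> nat -> R).

(** The cylinder event that the first [size s] claims are the entries of [s].
Independence is used only through the probabilities of these events. *)
Definition box (s : seq nat) : set T :=
  [set w | forall k, (k < size s)%N -> Y k w = nth 0%N s k].

Hypothesis mY : forall i a, measurable [set w | Y i w = a].
Hypothesis P_box : forall s a,
  fine (P (box (rcons s a))) = fine (P (box s)) * q (size s) a.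

Definition block_sum (i l : nat) (w : T) : nat := \sum_(i <= k < i + l) Y k w.

(** The convolution of the laws [q i], ..., [q (i + l - 1)]. *)
Fixpoint block_law (l i j : nat) : R :=
  if l is l'.+1 then \sum_(a < j.+1) q i a * block_law l' i.+1 (j - a)
  else (j == 0%N)%:R.

Lemma block_sum0 i w : block_sum i 0 w = 0%N.
Proof. by rewrite /block_sum addn0 big_geq. Qed.

Lemma block_sumS i l w :
  block_sum i l.+1 w = (Y i w + block_sum i.+1 l w)%N.
Proof. by rewrite /block_sum addnS big_ltn ?ltnS ?leq_addr // addSn. Qed.

Lemma block_sumD i l l' w :
  block_sum i (l + l') w = (block_sum i l w + block_sum (i + l) l' w)%N.
Proof. by rewrite /block_sum addnA -big_cat_nat ?leq_addr. Qed.

Lemma measurable_block_sum i l j : measurable [set w | block_sum i l w = j].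
Proof.
elim: l i j => [|l IHl] i j.
  under eq_set do rewrite block_sum0.
  case: j => [|j].
    by rewrite (_ : [set w | _] = setT) //; apply/seteqP; split.
  by rewrite (_ : [set w | _] = set0) //; apply/seteqP; split.
rewrite (_ : [set w | _] = \big[setU/set0]_(a < j.+1)
    ([set w | Y i w = a] `&` [set w | block_sum i.+1 l w = j - a]%N)).
  by apply: bigsetU_measurable => a _; exact: measurableI.
rewrite -(bigcup_mkord j.+1 (fun a =>
  [set w | Y i w = a] `&` [set w | block_sum i.+1 l w = j - a]%N)).
apply/seteqP; split => w /=; rewrite block_sumS.
  by move=> <-; exists (Y i w) => /=; [rewrite ltnS leq_addr|rewrite addKn].
by move=> [a /= aj [-> ->]]; rewrite subnKC.
Qed.

Lemma measurable_box s : measurable (box s).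
Proof.
rewrite (_ : box s = \bigcap_(k < size s) [set w | Y k w = nth 0%N s k]) //.
exact: bigcap_measurableType.
Qed.

Lemma boxS s a : box (rcons s a) = box s `&` [set w | Y (size s) w = a].
Proof.
apply/seteqP; split => [w|w [ws wa] k]; rewrite /box /= size_rcons => wsa.
  split=> [k ks|]; last by rewrite wsa ?nth_rcons ?ltnn ?eqxx.
  by rewrite wsa ?nth_rcons ?ks // ltnW.
rewrite nth_rcons; move: wsa; rewrite ltnS leq_eqVlt => /predU1P[->|ks].
  by rewrite ltnn eqxx.
by rewrite ks; exact: ws.
Qed.

(** A block sum is independent of the past cylinder [box s] and of an event [F]
that is itself independent of all longer pasts. Recording the block claim by
claim turns [box s] into such a longer past, so the proof is by induction on the
length of the block, with the past generalized. *)
Lemma prob_block (l i j : nat) (F : set T) (f : R) (s : seq nat) :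
  measurable F ->
  (forall s', size s' = (i + l)%N ->
     fine (P (box s' `&` F)) = fine (P (box s')) * f) ->
  size s = i ->
  fine (P (box s `&` ([set w | block_sum i l w = j] `&` F))) =
  fine (P (box s)) * block_law l i j * f.
Proof.
move=> mF; elim: l i j s => [|l IHl] i j s indepF si.
  under [X in X `&` F]eq_set do rewrite block_sum0.
  case: j => [|j] /=.
    rewrite mulr1 -indepF ?addn0 //; congr (fine (P (_ `&` _))).
    by apply/seteqP; split => [w []|].
  rewrite mulr0 mul0r (_ : _ `&` _ = set0) ?measure0 //.
  by apply/seteqP; split => [w [_ []]|].
have mV := measurable_block_sum.
rewrite (@prob_classify _ _ _ _ _ (Y i) j.+1) //; first last.
- by move=> w [_ [/= <- _]]; rewrite block_sumS ltnS leq_addr.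
- by do ![apply: measurableI => //]; exact: measurable_box.
rewrite /= mulr_sumr mulr_suml; apply: eq_bigr => a _.
transitivity (fine (P (box (rcons s a) `&`
    ([set w | block_sum i.+1 l w = j - a]%N `&` F)))).
  congr (fine (P _)); rewrite boxS si; apply/seteqP; split => w /=.
    rewrite block_sumS => -[[ws [Vj Fw]] wa]; do !split => //=.
    by rewrite -wa; lia.
  move=> [[ws wa] [wV Fw]]; do !split => //.
  by rewrite block_sumS wa wV subnKC // -ltnS.
rewrite IHl ?size_rcons ?si // ?P_box ?si ?mulrA // => s' ss'.
by apply: indepF; rewrite addnS.
Qed.

Lemma prob_block_sum l j :
  fine (P [set w | block_sum 0 l w = j]) = block_law l 0 j.
Proof.
have box_nil : box [::] = setT by apply/seteqP; split.
have := @prob_block l 0 j setT 1 [::] measurableT.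
rewrite box_nil setTI setIT probability_setT /= mul1r mulr1; apply=> // s' _.
by rewrite setIT mulr1.
Qed.

Section Periodic.
Variables (N m : nat).
Hypothesis q_periodic : forall i a, q (i + N)%N a = q i a.

Lemma block_law_periodic l k j : block_law l (k * N) j = block_law l 0 j.
Proof.
suff shift i : block_law l (i + N) j = block_law l i j.
  by elim: k => // k IHk; rewrite mulSn addnC shift.
elim: l i j => //= l IHl i j; apply: eq_bigr => a _.
by rewrite q_periodic -addSn IHl.
Qed.

(** Solvency is observed only at the ends of the first [n] periods, with initial
surplus [v] before claim [i] and premium income [m] in each period. *)
Definition solvent (n i v : nat) : set T :=
  [set w | forall k, (k <= n)%N -> (block_sum i (k * N) w <= v + k * m)%N].

Lemma measurable_solvent n i v : measurable (solvent n i v).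
Proof.
rewrite (_ : solvent n i v =
    \bigcap_(k < n.+1) [set w | (block_sum i (k * N) w <= v + k * m)%N]) //.
apply: bigcap_measurableType => k _.
rewrite (_ : [set w | _] = \bigcup_(j < (v + k * m).+1)
    [set w | block_sum i (k * N) w = j]).
  by apply: bigcup_measurable => j _; exact: measurable_block_sum.
apply/seteqP; split => [w /= le|w [j /= jle ->]//].
by exists (block_sum i (k * N) w).
Qed.

(** First-step analysis: the sum [j] of the first block splits the event, and the
rest is the same event one period later with surplus [v + m - j]. The past [s] is
carried along because the induction hypothesis serves as the independence
hypothesis of [prob_block]. *)
Lemma prob_solvent n k v s : size s = (k * N)%N ->
  fine (P (box s `&` solvent n (k * N) v)) =
  fine (P (box s)) * survival m (block_law N 0) n v.
Proof.
elim: n k v s => [|n IHn] k v s sk.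
  rewrite mulr1 (_ : solvent _ _ _ = setT) ?setIT //.
  apply/seteqP; split => // w _ [|//] _.
  by rewrite mul0n block_sum0.
have mV := measurable_block_sum.
have mE := measurable_solvent.
rewrite (@prob_classify _ _ _ _ _ (block_sum (k * N) N) (v + m).+1) //;
  first last.
- by move=> w [_ /(_ 1%N isT)]; rewrite !mul1n ltnS.
- by apply: measurableI => //; exact: measurable_box.
rewrite /= -/(survival _ _ _) /survival_step mulr_sumr; apply: eq_bigr => j _.
rewrite mulrA -(block_law_periodic N k).
rewrite -(@prob_block _ _ _ (solvent n (k * N + N) (v + m - j))) //; last first.
  by move=> s' ss'; rewrite -mulSnr; apply: IHn; rewrite mulSnr.
congr (fine (P _)); rewrite -setIA; congr (_ `&` _); rewrite setIC.
apply/seteqP; split => w [/= wj wE]; split => //.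
  move=> k' k'n; have := wE k'.+1 k'n.
  by rewrite !mulSn block_sumD wj; have := ltn_ord j; lia.
(* At the index [0] solvency says nothing; the other indices shift by one. *)
move=> [|k'] k'n; first by rewrite mul0n block_sum0.
have := wE k' k'n.
by rewrite !mulSn block_sumD wj; have := ltn_ord j; lia.
Qed.

End Periodic.
End Blocks.

(** A natural number is the number of smaller ones: [V = \sum_i 1_(V > i)],
integrated term by term. *)
Lemma sum_tail_expectation (d : measure_display) (T : measurableType d)
    (R : realType) (P : probability T R) (V : T -> nat) (m : R) :
  (forall j, measurable [set w | V w = j]) ->
  (\int[P]_w (V w)%:R%:E = m%:E)%E ->
  \sum_(i < n) fine (P [set w | (i < V w)%N]) @[n --> \oo] --> m.
Proof.
move=> mV EV.
have mgt i : measurable [set w | (i < V w)%N].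
  rewrite (_ : [set w | _] = ~` \bigcup_(j < i.+1) [set w | V w = j]).
    by apply: measurableC; apply: bigcup_measurable => j _.
  apply/seteqP; split => w /=.
    by move=> iV [j /= ji wj]; move: iV; rewrite wj ltnNge -ltnS ji.
  by move=> nV; rewrite ltnNge; apply/negP => Vi; apply: nV; exists (V w).
have VE w : (V w)%:R%:E = (\sum_(i <oo) (\1_[set w | (i < V w)%N] w : R)%:E)%E.
  apply/esym/lim_near_cst => //; exists (V w) => // n /= Vn.
  rewrite sumEFin; congr (_%:E).
  rewrite (big_cat_nat (leq0n (V w)) Vn) /=.
  rewrite [X in _ + X]big_nat_cond [X in _ + X]big1 ?addr0 => [|i]; last first.
    rewrite andbT => /andP[Vi _]; rewrite indicE memNset //=.
    by apply/negP; rewrite -leqNgt.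
  rewrite big_nat (eq_bigr (fun=> 1)) => [|i /andP[_ iV]]; last first.
    by rewrite indicE mem_set.
  by rewrite -big_nat sumr_const_nat subn0.
have : (\sum_(i <oo) P [set w | (i < V w)%N] = m%:E)%E.
  rewrite -EV; under eq_integral do rewrite VE.
  rewrite integral_nneseries //.
    by apply: eq_eseriesr => i _; rewrite integral_indic // setIT.
  by move=> i; apply/measurable_EFinP; exact: measurable_indic.
move=> sumP.
have cvgP : (\sum_(0 <= i < n) P [set w | (i < V w)%N])%E @[n --> \oo] --> m%:E.
  by rewrite -sumP; apply: is_cvg_nneseries => i _ _; exact: measure_ge0.
rewrite (_ : (fun n => _) =
    fine \o (fun n => \sum_(0 <= i < n) P [set w | (i < V w)%N])%E).
  exact: fine_cvg cvgP.
apply/funext => n /=.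
rewrite -sum_fine ?big_mkord // => i _; exact: fin_num_measure.
Qed.

(** * The claims of the risk model *)

Section Claims.
Context (d : measure_display) (T : measurableType d) (R : realType).
Context (P : probability T R) (X : nat -> {RV P >-> R}).
Hypothesis X_indep : mutually_independent [set i | (1 <= i)%N] X.
Hypothesis X_ge0 : forall (i : nat) (w : T), (1 <= i)%N -> 0 <= X i w.
Hypothesis X_int : forall (i : nat) (w : T), (1 <= i)%N -> X i w \is a Num.int.

(** The truncation is exact by [natr_claim]; the shift makes the first [n] claims
those of index below [n], as [box] requires. *)
Definition claim (k : nat) (w : T) : nat := Num.truncn (X k.+1 w).

Definition claim_law (k a : nat) : R := fine (P [set w | claim k w = a]).

Lemma natr_claim k w : (claim k w)%:R = X k.+1 w.
Proof. by rewrite truncnK // natrEint X_int // X_ge0. Qed.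

Lemma claim_preimage k a :
  [set w | claim k w = a] = X k.+1 @^-1` [set a%:R].
Proof.
apply/seteqP; split => w /=; rewrite -natr_claim; first by move->.
by move/eqP; rewrite eqr_nat => /eqP.
Qed.

Lemma measurable_claim k a : measurable [set w | claim k w = a].
Proof.
rewrite claim_preimage -[X in measurable X]setTI.
exact: measurable_funP.
Qed.

Lemma prob_box s :
  fine (P (box claim s)) = \prod_(0 <= k < size s) claim_law k (nth 0%N s k).
Proof.
pose J := [fset i in iota 1 (size s)]%fset.
have memJ i : (i \in J) = (1 <= i < (size s).+1)%N.
  by rewrite !inE mem_iota.
have -> : box claim s =
    \bigcap_(j in [set` J]) (X j @^-1` [set (nth 0%N s j.-1)%:R]).
  apply/seteqP; split => w /= ws.
    move=> [|k] /=; rewrite memJ // => ks.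
    by rewrite -natr_claim ws.
  move=> k ks; apply/eqP; rewrite -(eqr_nat R) natr_claim; apply/eqP.
  by apply: (ws k.+1); rewrite /= memJ.
rewrite X_indep => [|j /=|j _ //]; last by rewrite memJ => /andP[].
rewrite (perm_big (iota 1 (size s))) /=; last first.
  apply: uniq_perm; rewrite ?iota_uniq ?fset_uniq // => i.
  by rewrite memJ mem_iota.
rewrite -[1%N]addn0 iotaDl big_map /index_iota subn0.
rewrite (eq_bigr (fun k => (claim_law k (nth 0%N s k))%:E)) => [|k _].
  by rewrite prodEFin.
by rewrite /claim_law claim_preimage fineK // fin_num_measure // -claim_preimage;
  exact: measurable_claim.
Qed.

Lemma prob_box_rcons s a :
  fine (P (box claim (rcons s a))) =
  fine (P (box claim s)) * claim_law (size s) a.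
Proof.
rewrite !prob_box size_rcons big_nat_recr //= nth_rcons ltnn eqxx.
congr (_ * _); apply: eq_big_nat => k /andP[_ ks].
by rewrite nth_rcons ks.
Qed.

Lemma claim_sumE n w : claim_sum X n w = (block_sum claim 0 n w)%:R.
Proof.
rewrite /claim_sum /block_sum natr_sum big_add1 /= add0n.
by apply: eq_bigr => k _; rewrite natr_claim.
Qed.

Lemma claim_law_periodic N :
  (forall i : nat, (1 <= i)%N -> same_distribution (X (i + N)%N) (X i)) ->
  forall i a, claim_law (i + N) a = claim_law i a.
Proof.
move=> X_per i a; rewrite /claim_law !claim_preimage -addSn.
by congr fine; exact: (X_per i.+1 isT [set a%:R]).
Qed.

End Claims.

(** * Certainty of ruin *)

Lemma ruin_eventE (d : measure_display) (T : measurableType d) (R : realType)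
    (P : probability T R) (c u : nat) (X : nat -> {RV P >-> R}) :
  [set w | (ruin_time c X u w < +oo)%E] =
  [set w | exists t, ruined_at c X u w t].
Proof.
apply/seteqP; split => w /=; rewrite /ruin_time; case: pselect => //= e.
by rewrite ltry.
Qed.

Lemma measurable_ruin (d : measure_display) (T : measurableType d)
    (R : realType) (P : probability T R) (c u : nat) (X : nat -> {RV P >-> R}) :
  measurable [set w | exists t, ruined_at c X u w t].
Proof.
rewrite (_ : [set w | _] = \bigcup_t [set w | ruined_at c X u w t]); last first.
  by apply/seteqP; split => w [t]; [exists t|move=> _; exists t].
apply: bigcup_measurable => t _.
rewrite /ruined_at; case: (0 < t)%N => /=; last first.
  by rewrite (_ : [set w | _] = set0) //; apply/seteqP; split.
have mS : measurable_fun setT (surplus c X u (t%:R : R)).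
  rewrite /surplus /claim_sum.
  apply: measurable_funB; first exact: measurable_cst.
  by apply: measurable_sum => i; exact: measurable_funP.
rewrite (_ : [set w | _] =
    setT `&` surplus c X u (t%:R : R) @^-1` [set` `]-oo, 0[%R]).
  by apply: mS => //; exact: measurable_itv.
by rewrite setTI; apply/seteqP; split => w /=; rewrite in_itv.
Qed.

Theorem theorem1 (d : measure_display) (T : measurableType d) (R : realType)
    (P : probability T R) (c N : nat) (X : nat -> {RV P >-> R})
    (c_gt0 : (0 < c)%N) (N_gt0 : (0 < N)%N)
    (X_indep : mutually_independent [set i | (1 <= i)%N] X)
    (X_ge0 : forall (i : nat) (w : T), (1 <= i)%N -> 0 <= X i w)
    (X_int : forall (i : nat) (w : T), (1 <= i)%N -> X i w \is a Num.int)
    (X_periodic : forall i : nat, (1 <= i)%N ->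
       same_distribution (X (i + N)%N) (X i))
    (net_profit_eq0 : ((c * N)%:R%:E - 'E_P[claim_sum X N] = 0)%E)
    (S_nondegenerate : (P [set w | claim_sum X N w = (c * N)%:R] < 1)%E) :
  forall u : nat, ruin_probability c X u = 1%E.
Proof.
move=> u.
have mY := measurable_claim X_ge0 X_int.
have P_box := prob_box_rcons X_indep X_ge0 X_int.
have q_per := claim_law_periodic X_ge0 X_int X_periodic.
have SE n w := claim_sumE X_ge0 X_int n w.
pose V := block_sum (claim X) 0 N.
have mV j : measurable [set w | V w = j] by exact: measurable_block_sum.
pose p := block_law (claim_law X) N 0.
have pE j : fine (P [set w | V w = j]) = p j by exact: prob_block_sum.
have p_ge0 j : 0 <= p j by rewrite -pE fine_ge0.
have tailE i : tail p i = fine (P [set w | (i < V w)%N]).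
  rewrite /tail.
  have mle : measurable [set w | (V w <= i)%N].
    rewrite (_ : [set w | _] = \bigcup_(j < i.+1) [set w | V w = j]).
      by apply: bigcup_measurable.
    by apply/seteqP; split => [w /= Vi|w [j /= ji ->] //]; exists (V w).
  have <- : fine (P [set w | (V w <= i)%N]) = \sum_(j < i.+1) p j.
    rewrite (@prob_classify _ _ _ _ _ V i.+1) //.
    apply: eq_bigr => j _; rewrite -pE; congr (fine (P _)).
    apply/seteqP; split => [w []//|w /= wj]; split => //=.
    by rewrite wj -ltnS.
  have -> : [set w | (i < V w)%N] = ~` [set w | (V w <= i)%N].
    by apply/seteqP; split => w /=; rewrite ltnNge => /negP.
  rewrite probability_setC // -[P _ in RHS]fineK ?fin_num_measure //.
have tail_ge0 i : 0 <= tail p i by rewrite tailE fine_ge0.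
have sum_tail : (fun n => \sum_(i < n) tail p i) @ \oo --> ((c * N)%:R : R).
  under eq_fun do under eq_bigr do rewrite tailE.
  apply: sum_tail_expectation => //.
  move/eqP: net_profit_eq0; rewrite sube_eq ?add0e // => /eqP ->.
  by rewrite unlock; apply: eq_integral => w _; rewrite SE.
have p_lt1 : p (c * N)%N < 1.
  rewrite -pE -lte_fin fineK ?fin_num_measure //.
  rewrite (_ : [set w | _] = [set w | claim_sum X N w = (c * N)%:R]) //.
  apply/seteqP; split => w /=; rewrite SE -/(V w).
    by move->.
  by move/eqP; rewrite eqr_nat => /eqP.
have m_gt0 : (0 < c * N)%N by rewrite muln_gt0 c_gt0.
have to0 := survival_cvg0 m_gt0 p_ge0 tail_ge0 sum_tail p_lt1 u.
rewrite /ruin_probability ruin_eventE.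
set ruin := [set w | _].
have mruin : measurable ruin by exact: measurable_ruin.
have mC := measurableC mruin.
(* A path that is never ruined is solvent at the end of every period. *)
have noruin n : fine (P (~` ruin)) <= survival (c * N) p n u.
  have := prob_solvent mY P_box (c * N) q_per n (k := 0) u (s := [::]) erefl.
  have -> : box (claim X) [::] = setT by apply/seteqP; split.
  rewrite setTI probability_setT mul1r => <-.
  have mE := measurable_solvent mY N (c * N) n (0 * N) u.
  apply: fine_le; rewrite ?fin_num_measure //.
  apply: le_measure; rewrite ?inE //.
  move=> w /= safe k _; have [->|k_gt0] := posnP k.
    by rewrite mul0n block_sum0.
  rewrite leqNgt; apply/negP => big_claims; apply: safe; exists (k * N)%N.
  rewrite /ruined_at muln_gt0 k_gt0 N_gt0 /= /surplus natrK SE.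
  rewrite -natrM -natrD subr_lt0 ltr_nat.
  by rewrite mulnCA.
have P0 : P (~` ruin) = 0%E.
  rewrite -[LHS]fineK ?fin_num_measure //.
  congr (_%:E); apply/eqP; rewrite eq_le fine_ge0 // andbT.
  rewrite -(cvg_lim _ to0) //; apply: limr_ge; first exact: cvgP to0.
  exact: nearW.
by have := probability_setC P mC; rewrite P0 setCK sube0.
Qed.
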